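(* $K_2=\frac13$.
   Context: Let $C_2=[-\tfrac12,\tfrac12]^2$, $\alpha C_2=[-\tfrac{\alpha}{2},\tfrac{\alpha}{2}]^2$, and $\Delta(C_2,\alpha)=\bigcup\{\alpha C_2+(m_1+\tfrac12,m_2+\tfrac12): m_1,m_2\in\mathbb{Z}_{\ge0}\}$, the union of closed squares of side $\alpha$ centred at the half-integer points of the closed first quadrant. A ray is $\{tv:t\ge0\}$ with $v\in(0,\infty)^2$; it is obstructed if it meets $\Delta(C_2,\alpha)$. $K_2$ is the infimum of all $\alpha\ge0$ such that $\Delta(C_2,\alpha)$ obstructs every ray with direction in $(0,\infty)^2$. *)

(* Defs.v *)
From HB Require Import structures.
From mathcomp Require Import all_boot all_order all_algebra.
From mathcomp Require Import all_classical all_reals.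
Set Implicit Arguments.
Unset Strict Implicit.
Unset Printing Implicit Defensive.
Import Order.TTheory GRing.Theory Num.Theory.
Local Open Scope classical_set_scope.
Local Open Scope ring_scope.

Definition C2 (R : realType) : set (R * R) :=
  `[- (1 / 2), 1 / 2]%classic `*` `[- (1 / 2), 1 / 2]%classic.

Arguments C2 : clear implicits.

Definition dilate (R : realType) (alpha : R) (C : set (R * R)) : set (R * R) :=
  [set (alpha * p.1, alpha * p.2) | p in C].

Definition translate (R : realType) (C : set (R * R)) (c : R * R) :
    set (R * R) :=
  [set (p.1 + c.1, p.2 + c.2) | p in C].

Definition Delta (R : realType) (C : set (R * R)) (alpha : R) : set (R * R) :=
  \bigcup_(m in [set: nat * nat])
    translate (dilate alpha C) (m.1%:R + 1 / 2, m.2%:R + 1 / 2).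

Definition ray (R : realType) (v : R * R) : set (R * R) :=
  [set (t * v.1, t * v.2) | t in [set t : R | 0 <= t]].

Definition obstructs (R : realType) (D : set (R * R)) (v : R * R) : Prop :=
  ray v `&` D !=set0.

(* [inf] is real-valued, with value 0 on the empty set. *)
Definition K2 (R : realType) : R :=
  inf [set alpha : R | 0 <= alpha /\
    forall v : R * R, 0 < v.1 -> 0 < v.2 -> obstructs (Delta (C2 R) alpha) v].

(* Main.v *)
(** For a ray of slope [r >= 1] parametrised as [(s, r s)], the closed squares of
    side [1/3] are met at [s = 1/3] when [r <= 2]; when [r >= 2], the image
    [[r/3, 2r/3]] of [s \in [1/3, 2/3]] is too long to fit in one of the open
    gaps, of length [2/3], between consecutive intervals [[n + 1/3, n + 2/3]].
    Slopes below 1 follow by symmetry. Conversely, the ray of slope 2 misses the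
    squares of any side smaller than [1/3]. *)
Require Import Defs.
From mathcomp Require Import all_boot all_order all_algebra.
From mathcomp Require Import all_classical all_reals.
From mathcomp Require Import lra.
Import Order.TTheory GRing.Theory Num.Theory.
Local Open Scope ring_scope.

(** A square of side [alpha] is a sup-norm ball of radius [alpha / 2], so the condition splits by
    coordinate. *)
Lemma obstructs_Delta_C2P (R : realType) (alpha : R) (v : R * R) : 0 <= alpha ->
  obstructs (Delta (C2 R) alpha) v <->
  exists (t : R) (m n : nat), [/\ 0 <= t,
    `|t * v.1 - (m%:R + 1 / 2)| <= alpha / 2 &
    `|t * v.2 - (n%:R + 1 / 2)| <= alpha / 2].
Proof.
move=> alpha_ge0; split.
- case=> p [[t /= t_ge0 <-{p}]] [[m n] _] [q [[x y]]] [] /=.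
  rewrite !in_itv /= => /andP[x1 x2] /andP[y1 y2] <-{q} /= [xE yE].
  exists t, m, n; split=> //; rewrite -?xE -?yE addrK ler_norml; apply/andP; split; nra.
- case=> t [m [n [t_ge0 tm tn]]].
  exists (t * v.1, t * v.2); split; first by exists t.
  have unscale (z : R) : `|z| <= alpha / 2 ->
      exists2 x, `[- (1 / 2), 1 / 2]%classic x & alpha * x = z.
    (* The preimage [z / alpha] needs [alpha != 0]; for [alpha = 0] the bound forces [z = 0]. *)
    have [->|alpha_neq0] := eqVneq alpha 0.
      rewrite mul0r normr_le0 => /eqP ->; exists 0; last by rewrite mul0r.
      by rewrite /= in_itv /=; apply/andP; split; lra.
    have alpha_gt0 : 0 < alpha by rewrite lt0r alpha_neq0.
    rewrite ler_norml => /andP[z1 z2]; exists (z / alpha).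
      by rewrite /= in_itv /= ler_pdivlMr // ler_pdivrMr //; apply/andP; split; lra.
    by rewrite mulrC divfK.
  have [x xC xE] := unscale _ tm; have [y yC yE] := unscale _ tn.
  exists (m, n) => //; exists (alpha * x, alpha * y); first by exists (x, y).
  by rewrite /= xE yE !subrK.
Qed.

Lemma slope_ge1_meets_third (R : realType) (r : R) : 1 <= r ->
  exists (s : R) (n : nat), [/\ 0 <= s, `|s - 1 / 2| <= 1 / 6 &
    `|s * r - (n%:R + 1 / 2)| <= 1 / 6].
Proof.
move=> r_ge1; have [r_le2|r_gt2] := lerP r 2.
  exists (1 / 3), 0; rewrite add0r !ler_norml.
  by split; [lra | apply/andP; split; lra..].
(* [n] indexes the last interval starting at or before the right end of the image:
   [n + 1/3 <= 2r/3 < n + 4/3]. *)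
have := @truncn_itv R (r * 2 / 3 - 1 / 3); set n := Num.truncn _.
case/(_ _)/andP; first lra.
rewrite -[n.+1%:R]natr1 => n_le n_gt; have n_ge0 : 0 <= n%:R :> R := ler0n _ _.
have [r_le|r_gt] := lerP (r * 2 / 3) (n%:R + 2 / 3).
  exists (2 / 3), n; rewrite !ler_norml.
  by split; [lra | apply/andP; split; lra..].
have r_gt0 : 0 < r by lra.
(* Here the image passes the right end [n + 2/3] of that interval. Halving [2r/3 < n + 4/3] gives
   [r/3 < n + 2/3], so this end lies in the image. *)
exists ((n%:R + 2 / 3) / r), n; rewrite divfK ?gt_eqF // !ler_norml.
split; first by apply: divr_ge0; lra.
  by rewrite lerBrDr lerBlDr ler_pdivlMr // ler_pdivrMr //; apply/andP; split; lra.
by apply/andP; split; lra.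
Qed.

Lemma ray_meets_third (R : realType) (a b : R) : 0 < a -> a <= b ->
  exists (t : R) (m n : nat), [/\ 0 <= t,
    `|t * a - (m%:R + 1 / 2)| <= 1 / 6 & `|t * b - (n%:R + 1 / 2)| <= 1 / 6].
Proof.
move=> a_gt0 ab.
have [|s [n [s_ge0 s_mid sn]]] := @slope_ge1_meets_third R (b / a).
  by rewrite ler_pdivlMr // mul1r.
(* Rescaling by [a] makes the first coordinate [s], near [1/2]: the first column of squares
   suffices. *)
exists (s / a), 0, n; split; first by apply: divr_ge0 => //; exact: ltW.
  by rewrite divfK ?gt_eqF // add0r.
by rewrite mulrAC -mulrA.
Qed.

Lemma third_obstructs (R : realType) (v : R * R) : 0 < v.1 -> 0 < v.2 ->
  obstructs (Delta (C2 R) (1 / 3)) v.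
Proof.
move=> v1_gt0 v2_gt0; apply/obstructs_Delta_C2P; first lra.
have -> : 1 / 3 / 2 = 1 / 6 :> R by lra.
have [v12|/ltW v21] := lerP v.1 v.2; first exact: ray_meets_third.
by have [t [m [n [? ? ?]]]] := ray_meets_third _ _ _ v2_gt0 v21; exists t, n, m.
Qed.

Lemma slope2_obstructed_ge_third (R : realType) (alpha : R) : 0 <= alpha ->
  obstructs (Delta (C2 R) alpha) (1, 2) -> 1 / 3 <= alpha.
Proof.
move=> alpha_ge0 /obstructs_Delta_C2P[//|t [m [n [_ /=]]]].
rewrite !ler_norml => /andP[m1 m2] /andP[n1 n2].
rewrite leNgt; apply/negP => alpha_lt.
(* Doubling the bound on [t] puts [2m + 1] within [alpha + alpha/2 < 1/2] of [n + 1/2], so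
   [2m < n < 2m + 1], impossible for integers. *)
have : (m * 2 < n)%N by rewrite -(ltr_nat R) natrM; lra.
have : (n < (m * 2).+1)%N by rewrite -(ltr_nat R) -[_.+1%:R]natr1 natrM; lra.
by rewrite ltnS leqNgt => /negP.
Qed.

Theorem theorem20 (R : realType) : K2 R = 1 / 3.
Proof.
apply/eqP; rewrite eq_le; apply/andP; split.
- apply: ge_inf; first by exists 0 => alpha [].
  by split; [lra | exact: third_obstructs].
- apply: lb_le_inf; first by exists (1 / 3); split; [lra | exact: third_obstructs].
  move=> alpha [alpha_ge0 obs]; apply: slope2_obstructed_ge_third => //.
  by apply: obs => /=; lra.
Qed.
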